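(* Fix an integer $M\geq 3$, and let $N\geq M$ vary. Any configuration $g\in V\setminus V_c$ can be reached from any configuration $f\in V$ by a directed path in $G(N,M)$ of length $O(N^2)$. In particular, $V\setminus V_c$ is a strongly connected component of $G(N,M)$, with $\Theta(M^N)$ vertices and diameter $O(N^2)$.
   Context: For a positive integer $K$ write $[K]=\{1,\ldots,K\}$. For integers $N\geq 1$, $M\geq 2$, let $V=\{f:[N]\to[M]\}$ be the set of all functions (called configurations of $N$ people in $M$ rooms) and let $E\subseteq V\times V$ be the set of pairs $(f,g)$ such that for all $k\in[N]$: $g(k)\neq f(k)$ if and only if $k=\max f^{-1}(f(k))$. Then $G(N,M)=(V,E)$ is a directed graph. For $M\le N$, $V_c\subseteq V$ is the set of configurations $f$ whose restriction to $\{N-M+1,\ldots,N\}$ is constant. The diameter of a strongly connected component is the maximum, over ordered pairs of its vertices, of the length of a shortest directed path from the first to the second. Asymptotic notation is with $M$ fixed and $N\to\infty$: $a(N)=O(b(N))$ means $a(N)\leq c\,b(N)$ for some constant $c>0$ and all sufficiently large $N$; $a(N)=\Theta(b(N))$ means $a(N)=O(b(N))$ and $b(N)=O(a(N))$. The first assertion means that the maximum over $f\in V$, $g\in V\setminus V_c$ of the directed distance from $f$ to $g$ is $O(N^2)$. *)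

(* Defs.v *)
From mathcomp Require Import all_boot.

Set Implicit Arguments.
Unset Strict Implicit.
Unset Printing Implicit Defensive.

Section Digraph.
Variables (T : finType) (e : rel T).

(* The strongly connected components, as sets of vertices: the classes of the
   equivalence relation "each vertex can be reached from the other". *)
Definition sccs : {set {set T}} :=
  equivalence_partition (fun x y => connect e x y && connect e y x) [set: T].

Definition has_walk (x y : T) (n : nat) : bool :=
  [exists p : n.-tuple T, path e x p && (last x p == y)].

(* The length of a shortest directed path from [x] to [y]. Such a length is
   less than [#|T|], and [find] returns [#|T|] if there is no path. *)
Definition dist (x y : T) : nat := find (has_walk x y) (iota 0 #|T|).

Definition diameter (C : {set T}) : nat :=
  \max_(x in C) \max_(y in C) dist x y.

Lemma has_walkP x y n :
  reflect (exists p, [/\ size p = n, path e x p & last x p = y])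
          (has_walk x y n).
Proof.
apply: (iffP existsP) => [[p /andP[pth /eqP lst]]|[p [sz pth lst]]].
  by exists p; rewrite size_tuple.
have szp : size p == n by apply/eqP.
by exists (Tuple szp); rewrite /= pth lst eqxx.
Qed.

Lemma dist_path x p : path e x p -> (dist x (last x p) <= size p)%N.
Proof.
move=> pth; set y := last x p; rewrite leqNgt; apply/negP => lt_sz.
have lt_card : (size p < #|T|)%N.
  apply: leq_trans lt_sz _; rewrite /dist -[leqRHS](size_iota 0).
  exact: find_size.
have := before_find 0%N lt_sz; rewrite nth_iota // add0n.
by move/has_walkP; apply; exists p.
Qed.

Lemma dist_connect x y :
  connect e x y ->
  exists p, [/\ size p = dist x y, path e x p & last x p = y].
Proof.
case/connectP => p0 pth0 ->; case: (shortenP pth0) => p pth unq _.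
have lt_card : (size p < #|T|)%N.
  by have := max_card [in x :: p]; rewrite (card_uniqP unq).
have lt_dist : (dist x (last x p) < #|T|)%N.
  exact: leq_ltn_trans (dist_path pth) lt_card.
apply/has_walkP; have := lt_dist.
rewrite {1}/dist -[X in (_ < X)%N](size_iota 0) -has_find.
by move=> /(nth_find 0%N); rewrite nth_iota.
Qed.

Lemma dist_nconnect x y : ~~ connect e x y -> dist x y = #|T|.
Proof.
move=> ncon; rewrite /dist hasNfind ?size_iota //.
apply/hasPn => n _; apply/has_walkP => -[p [_ pth lst]].
by case/connectP: ncon; exists p.
Qed.

End Digraph.

(* People and rooms are numbered from 0 here, so that the people
   N-M+1, ..., N are the k : 'I_N with N - M <= k. *)
Definition config (N M : nat) := {ffun 'I_N -> 'I_M}.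

(* [\max] is the maximum of a set of natural numbers; the set
   f^-1(f(k)) over which it is taken contains k. *)
Definition move (N M : nat) : rel (config N M) := fun f g =>
  [forall k : 'I_N,
     (g k != f k) == (k == \max_(j in f @^-1: [set f k]) j :> nat)].

Definition Vc (N M : nat) : {set config N M} :=
  [set f : config N M | [forall i : 'I_N, forall j : 'I_N,
     ((N - M <= i) && (N - M <= j)) ==> (f i == f j)]]%N.

(* Main.v *)
Require Import Defs.
From mathcomp Require Import all_boot all_order all_algebra perm fingroup zify.
From mathcomp Require Import classical_sets reals topology normedtype landau.
From mathcomp Require Import fintype finset.

Set Implicit Arguments.
Unset Strict Implicit.
Unset Printing Implicit Defensive.

Import GRing.Theory Num.Theory.

(** In one move, the highest person of every occupied room leaves for another
    room of his choice, and nobody else moves. Call the [M] highest people the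
    controls. If they occupy pairwise different rooms then every room is
    covered, all other people (the low ones) are frozen, and the controls may
    be shifted around the cycle of rooms for ever. Fix a permutation [s] of the
    rooms and write [place s t l] for the configuration in which control [i]
    is in room [s i + t] and the low people are placed according to [l]. The
    path from [f] to [g] has four stages.

    - From any [f], at most [M] moves lead to some [place s t l] ([align]). The
      controls are brought into position from the highest downwards, each at
      the price of one move, by a suitable choice of the shift [t].
    - Three moves take the highest low person of one room to any other room,
      keep the other low people fixed, and keep the controls in the pattern
      [s] ([lowreach_put]). The low people can thus be moved one at a time, and
      any arrangement of them can be produced from the lowest person upwards
      in quadratically many such moves ([lowreach_all]).
    - One move adjusts the shift to [0] ([reach_rotate]).
    - If [s i] differs from the room of control [i] in [g], for all [i], then
      one last move leads to [g] ([move_place]). A permutation [s] avoiding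
      one prescribed value at each point exists unless these values are all
      equal ([perm_avoid]), that is, unless [g] is in [Vc].

    No move ends in [Vc] ([Vc_no_pred]), so [~: Vc] is a whole component. It
    contains at least half of all configurations, because moving only the
    highest person maps [Vc] injectively into its complement ([card_Vc]). *)

(** * Permutations avoiding one value at each point *)

(** A permutation with the fewest bad points [k], where [s k = a k], has none:
    exchanging the values at a bad point [k] and at some [l] with [a l != a k]
    repairs [k] and makes [l] good. *)
Lemma perm_avoid (T : finType) (a : T -> T) (x y : T) :
  a x != a y -> exists s : {perm T}, forall k, s k != a k.
Proof.
move=> axy.
case: (@arg_minnP {perm T} 1%g xpredT (fun s => #|[set k | s k == a k]|)) => //.
move=> s _ smin; exists s => k; apply/negP => /eqP sk.
have [l al] : exists l, a l != a k.
  case: (eqVneq (a x) (a k)) => [axk|]; last by exists x.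
  by exists y; rewrite -axk eq_sym.
have kl : k != l by apply: contraNneq al => ->.
have := smin (tperm k l * s)%g isT; rewrite leqNgt => /negP; apply.
apply: proper_card; apply/properP; split.
  apply/subsetP => i; rewrite !inE permM; case: tpermP => [->|->|] //.
  - by rewrite -sk (inj_eq perm_inj) eq_sym (negPf kl).
  - by rewrite sk eq_sym (negPf al).
exists k; first by rewrite inE sk.
by rewrite inE permM tpermL -sk (inj_eq perm_inj) eq_sym.
Qed.

(** * Moves and walks *)

Section Moves.
Variables N M : nat.
Implicit Types f g : config N M.

Definition top f (k : 'I_N) := [forall j, (f j == f k) ==> (j <= k)].

Lemma moveP f g :
  reflect (forall k, (g k != f k) = top f k) (@move N M f g).
Proof.
have topE k : top f k = (k == \max_(j in f @^-1: [set f k]) j :> nat).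
  have lek : k <= \max_(j in f @^-1: [set f k]) j.
    by apply: (@leq_bigmax_cond _ _ (fun j : 'I_N => j : nat)); rewrite !inE.
  rewrite eqn_leq lek; apply/forallP/bigmax_leqP => [h j|h j].
    by rewrite !inE; apply/implyP/h.
  by apply/implyP => fj; apply: h; rewrite !inE.
by apply: (iffP forallP) => h k; [rewrite topE (eqP (h k)) | rewrite -topE h].
Qed.

Lemma topP f k : reflect (forall j, f j = f k -> j <= k) (top f k).
Proof.
apply: (iffP forallP) => h j; first by move=> /eqP; apply/implyP/h.
by apply/implyP => /eqP; apply: h.
Qed.

Lemma topPn f k : reflect (exists2 j, f j = f k & k < j) (~~ top f k).
Proof.
apply: (iffP idP) => [|[j fj kj]].
  rewrite negb_forall => /existsP[j]; rewrite negb_imply -ltnNge => /andP[/eqP].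
  by exists j.
by apply/negP => /topP /(_ _ fj); rewrite leqNgt kj.
Qed.

Definition step f (d : 'I_N -> 'I_M) : config N M :=
  [ffun k => if top f k then d k else f k].

Lemma move_step f d : (forall k, top f k -> d k != f k) -> move f (step f d).
Proof.
by move=> h; apply/moveP => k; rewrite ffunE; case: ifP => [/h ->|];
  rewrite ?eqxx.
Qed.

Definition reach c f g :=
  exists p, [/\ path (@move N M) f p, last f p = g & size p <= c].

Lemma reach0 f : reach 0 f f. Proof. by exists [::]. Qed.

Lemma reach1 f g : move f g -> reach 1 f g.
Proof. by exists [:: g]; rewrite /= andbT. Qed.

Lemma reach_trans c1 c2 f g h :
  reach c1 f g -> reach c2 g h -> reach (c1 + c2) f h.
Proof.
move=> [p [pp <- sp]] [q [pq <- sq]]; exists (p ++ q).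
by rewrite cat_path pp pq last_cat size_cat leq_add.
Qed.

Lemma reach_leq c1 c2 f g : c1 <= c2 -> reach c1 f g -> reach c2 f g.
Proof. by move=> le [p [? ? /leq_trans ]]; exists p; split; auto. Qed.

End Moves.

(** * Steering the highest people *)

Section Controls.
(* The people [lshift M x] are the low ones and the people [rshift n i] are the
   controls. A number of rooms of the form [m.+3] makes the rooms a cyclic
   group with [1 + 1 != 0]. *)
Variables n m : nat.
Local Notation M := m.+3.
Local Notation N := (n + M).
Implicit Types (f g : config N M) (l : {ffun 'I_n -> 'I_M}) (t : 'I_M).
Local Open Scope ring_scope.

Lemma addr1_neq (u : 'I_M) : u + 1 != u.
Proof. by rewrite -subr_eq0 addrAC subrr. Qed.

Lemma two_neq0 : (1 + 1 : 'I_M) != 0. Proof. by []. Qed.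

Lemma exists_third (u v : 'I_M) : exists w, (w != u) && (w != v).
Proof.
apply/existsP; apply: contraT; rewrite negb_exists => /forallP h.
have : (#|[set: 'I_M]| <= #|[set u; v]|)%N.
  by apply/subset_leq_card/subsetP => w _; rewrite !inE; have := h w;
     rewrite negb_and !negbK.
by rewrite cardsT card_ord cards2; case: (_ != _).
Qed.

Section Perm.
Variable s : {perm 'I_M}.

Definition place t (l : {ffun 'I_n -> 'I_M}) : config N M :=
  [ffun k => match split k with inl x => l x | inr i => s i + t end].

Lemma place_low t l x : place t l (lshift M x) = l x.
Proof. by rewrite ffunE (unsplitK (inl x)). Qed.

Lemma place_ctrl t l i : place t l (rshift n i) = s i + t.
Proof. by rewrite ffunE (unsplitK (inr i)). Qed.

Lemma top_place t l k : top (place t l) k = (n <= k)%N.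
Proof.
case: (split_ordP k) => [x ->|i ->] /=.
  rewrite leqNgt ltn_ord; apply/negbTE/topPn.
  exists (rshift n (s^-1 (l x - t)))%g; last by rewrite /= ltn_addr.
  by rewrite place_ctrl permKV place_low subrK.
rewrite leq_addr; apply/topP => j.
case: (split_ordP j) => [x ->|i' ->]; first by rewrite /= ltnW // ltn_addr.
by rewrite !place_ctrl => /addIr /perm_inj ->.
Qed.

Lemma move_place t l g :
    (forall i, g (rshift n i) != s i + t) -> (forall x, g (lshift M x) = l x) ->
  move (place t l) g.
Proof.
move=> gc gl; apply/moveP => k; rewrite top_place.
case: (split_ordP k) => [x ->|i ->] /=.
  by rewrite gl place_low eqxx leqNgt ltn_ord.
by rewrite place_ctrl gc leq_addr.
Qed.

Lemma move_rotate t t' l : t' != t -> move (place t l) (place t' l).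
Proof.
move=> tt'; apply: move_place => [i|x]; last by rewrite place_low.
by rewrite place_ctrl (inj_eq (addrI _)).
Qed.

Lemma reach_rotate t t' l : reach 1 (place t l) (place t' l).
Proof.
have [->|tt'] := eqVneq t' t; first exact: reach_leq (reach0 _).
exact/reach1/move_rotate.
Qed.

(** The highest [j] controls are in the pattern [s] up to a shift [t]. Since
    nobody above them interferes, they may all be moved to any other shift
    [t']. The next control [i0] is free or blocked. If free, he moves to
    [s i0 + t'], where [t'] only has to avoid [t] and the value for which he
    would not move; this is where three rooms are needed. If blocked, he stays
    where he is, and [t'] is chosen so that his room is [s i0 + t']; this [t']
    is not [t] because the shift [t] puts a higher control in that room. *)
Lemma align_some j f : (j <= M)%N ->
  exists t f', reach j f f' /\
    forall i : 'I_M, (M - j <= i)%N -> f' (rshift n i) = s i + t.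
Proof.
elim: j => [_|j IHj jM].
  exists 0, f; split; first exact: reach0.
  by move=> i; rewrite subn0 leqNgt ltn_ord.
have [t [f' [rf f'E]]] := IHj (ltnW jM).
have i0P : (M - j.+1 < M)%N by rewrite ltn_subrL.
pose i0 := Ordinal i0P; set k0 := rshift n i0.
have above (i : 'I_M) : (i0 < i)%N -> f' (rshift n i) = s i + t.
  by move=> lt; apply: f'E; rewrite -subSS subSn.
have topab (i : 'I_M) : (i0 < i)%N -> top f' (rshift n i).
  move=> lt; apply/topP => k.
  case: (split_ordP k) => [x ->|i' ->]; first by rewrite /= ltnW // ltn_addr.
  rewrite leqNgt (above i) // => fk; apply/negP; rewrite /= ltn_add2l => lt'.
  move: fk; rewrite (above i'); last exact: ltn_trans lt lt'.
  by move=> /addIr /perm_inj ii'; rewrite ii' ltnn in lt'.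
have [t' [tt' t'P]] : exists t', t' != t /\
    if top f' k0 then is_true (s i0 + t' != f' k0) else s i0 + t' = f' k0.
  case: (boolP (top f' k0)) => [_|/topPn[k]].
    have [t' /andP[? t'n]] := exists_third t (f' k0 - s i0).
    exists t'; split=> //; apply: contraNneq t'n => <-.
    by rewrite addrAC subrr add0r.
  case: (split_ordP k) => [x ->|i' -> fk] /=.
    by rewrite ltnNge ltnW // ltn_addr.
  rewrite ltn_add2l => lt; exists (f' k0 - s i0).
  split; last by rewrite addrC subrK.
  rewrite -fk above //.
  apply: contraTneq lt => e.
  suff /perm_inj -> : s i' = s i0 by rewrite ltnn.
  by apply/(addIr t); rewrite -{2}e [RHS]addrC subrK.
(* Any other room would do for the people below [i0]. *)
pose d (k : 'I_N) :=
  if split k is inr i then if (i0 <= i)%N then s i + t' else f' k + 1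
  else f' k + 1.
exists t', (step f' d); split.
  rewrite -[j.+1]addn1; apply: reach_trans rf _; apply/reach1/move_step => k tk.
  rewrite /d; case: split_ordP => [x _|i ek]; first exact: addr1_neq.
  case: ifPn => le; last exact: addr1_neq.
  move: le; rewrite leq_eqVlt => /orP[/eqP/val_inj ei|lt].
    by move: t'P; rewrite /k0 ei -ek tk.
  by rewrite ek above // (inj_eq (addrI _)).
move=> i le; rewrite ffunE /d (unsplitK (inr i)) le.
move: le; rewrite leq_eqVlt => /orP[/eqP ei|lt]; last by rewrite topab.
have -> : i = i0 by apply/val_inj.
by case: ifP t'P => // _ ->.
Qed.

Lemma align f : exists t l, reach M f (place t l).
Proof.
have [t [f' [rf f'E]]] := align_some f (leqnn M).
exists t, [ffun x => f' (lshift M x)].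
suff -> : place t [ffun x => f' (lshift M x)] = f' by [].
apply/ffunP => k; case: (split_ordP k) => [x ->|i ->].
  by rewrite place_low ffunE.
by rewrite place_ctrl f'E // subnn.
Qed.

Definition put l x c : {ffun 'I_n -> 'I_M} :=
  [ffun y => if y == x then c else l y].

(** The final shift of the controls is left free, because moving a low person
    rotates them; the factor 3 is the cost of moving one low person once. *)
Definition lowreach c l l' :=
  forall t, exists t', reach (3 * c) (place t l) (place t' l').

Lemma lowreach0 l : lowreach 0 l l.
Proof. by move=> t; exists t; apply: reach0. Qed.

Lemma lowreach_trans c1 c2 l1 l2 l3 :
  lowreach c1 l1 l2 -> lowreach c2 l2 l3 -> lowreach (c1 + c2) l1 l3.
Proof.
move=> r1 r2 t; have [t' r] := r1 t; have [t'' r'] := r2 t'.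
by exists t''; rewrite mulnDr; apply: reach_trans r r'.
Qed.

Lemma lowreach_leq c1 c2 l l' :
  (c1 <= c2)%N -> lowreach c1 l l' -> lowreach c2 l l'.
Proof.
move=> le r t; have [t' r'] := r t; exists t'; apply: reach_leq r'.
by rewrite leq_mul2l le orbT.
Qed.

(** First rotate the controls until the highest of them is in the room [r] of
    [x]. In the second move all controls advance by one room, except that the
    control [v] who is in [r - 1] advances by two. This uncovers [r] and no
    other room, and puts [v] under the highest control in [r + 1]. In the third
    move [v] is therefore blocked, the other controls advance by one more room,
    and [x] leaves [r]. All controls have then advanced by two rooms. *)
Lemma lowreach_put l (x : 'I_n) c :
    (forall y, l y = l x -> (y <= x)%N) -> c != l x ->
  lowreach 1 l (put l x c).
Proof.
move=> xtop cx t0; pose r := l x.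
have [t tE] : exists t, s ord_max + t = r.
  by exists (r - s ord_max); rewrite addrC subrK.
pose v := (s^-1 (r - 1 - t))%g.
have sv : s v + t = r - 1 by rewrite permKV subrK.
have vmax : v != ord_max.
  apply/eqP => e; have : r - 1 != r.
    by rewrite -subr_eq0 addrAC subrr sub0r oppr_eq0.
  by rewrite -sv e tE eqxx.
exists (t + 1 + 1).
apply: (@reach_trans _ _ 1 2); first exact: (reach_rotate _ t).
pose f1 : config N M := [ffun k => match split k with inl y => l y
   | inr i => if i == v then r + 1 else s i + t + 1 end].
have f1l y : f1 (lshift M y) = l y by rewrite ffunE (unsplitK (inl y)).
have f1c i : f1 (rshift n i) = if i == v then r + 1 else s i + t + 1.
  by rewrite ffunE (unsplitK (inr i)).
apply: (@reach_trans _ _ 1 1 _ f1).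
  apply/reach1/move_place => // i; rewrite f1c; have [->|_] := eqVneq i v.
    by rewrite sv -subr_eq0 opprB addrA [r + 1]addrC addrAC addrK two_neq0.
  exact: addr1_neq.
apply/reach1/moveP => k; case: (split_ordP k) => [y ->|i ->].
  rewrite place_low f1l ffunE; have [->|yx] := eqVneq y x.
    rewrite cx; apply/esym/topP => j.
    case: (split_ordP j) => [z ->|i ->]; rewrite f1l ?f1c.
      by rewrite f1l => /xtop.
    rewrite -/r; case: eqP => [_ /eqP|/eqP iv].
      by rewrite (negPf (addr1_neq _)).
    move=> e; case/eqP: iv; apply: (@perm_inj _ s); apply: (addIr t).
    by rewrite sv -e addrK.
  rewrite eqxx; apply/esym/negbTE/topPn.
  have [ly|ly] := eqVneq (l y) r.
    exists (lshift M x); first by rewrite !f1l ly.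
    by rewrite /= ltn_neqAle [_ == _](negPf yx) xtop.
  exists (rshift n (s^-1 (l y - 1 - t))%g); last by rewrite /= ltn_addr.
  rewrite f1l f1c permKV; case: eqP => [e|_]; last by rewrite !subrK.
  case/eqP: ly; apply: (addIr (-1)); rewrite -sv -e.
  by rewrite permKV subrK.
rewrite place_ctrl f1c; have [->|iv] := eqVneq i v.
  rewrite !addrA sv subrK eqxx; apply/esym/negbTE/topPn.
  exists (rshift n ord_max).
    by rewrite !f1c eqxx eq_sym (negPf vmax) tE.
  rewrite /= ltn_add2l ltn_neqAle -ltnS ltn_ord andbT.
  by apply: contraNneq vmax => e; apply/eqP/val_inj.
rewrite !addrA addr1_neq; apply/esym/topP => j.
case: (split_ordP j) => [z ->|i' ->]; first by rewrite /= ltnW // ltn_addr.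
rewrite !f1c (negPf iv); have [->|i'v] := eqVneq i' v; last first.
  by move=> /addIr /addIr /perm_inj ->.
move=> /addIr e; suff -> : i = ord_max by rewrite /= leq_add2l -ltnS.
by apply: (@perm_inj _ s); apply: (addIr t); rewrite -e tE.
Qed.

(** The people above [x] in his room leave it one by one, from the highest
    down; then [x] is free to move. *)
Lemma lowreach_one b l (x : 'I_n) c :
    (#|[set y | (l y == l x) && (x < y)%N]| < b)%N ->
  exists l', [/\ lowreach b l l', l' x = c &
    forall y : 'I_n, (y < x)%N -> l' y = l y].
Proof.
elim: b l => [//|b IHb] l le.
have [->|cx] := eqVneq c (l x).
  by exists l; split=> //; apply: lowreach_leq (lowreach0 _).
have [/forallP xtop|] := boolP [forall y, (l y == l x) ==> (y <= x)%N].
  exists (put l x c); split=> [||y yx].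
  - apply: (@lowreach_leq 1) => //; apply: lowreach_put => // y /eqP.
    exact/implyP/xtop.
  - by rewrite ffunE eqxx.
  - by rewrite ffunE ifN //; apply: contraTneq yx => ->; rewrite ltnn.
rewrite negb_forall => /existsP[y0]; rewrite negb_imply -ltnNge => y0P.
case: (@arg_maxnP _ y0 (fun y => (l y == l x) && (x < y)%N) val y0P) => y.
move=> /andP[/eqP ly xy] ymax; pose l1 := put l y (l y + 1).
have r1 : lowreach 1 l l1.
  apply: lowreach_put => [z lz|]; last exact: addr1_neq.
  have [xz|zx] := ltnP x z; last exact: leq_trans (ltnW xy).
  by apply: ymax; rewrite lz ly eqxx.
have nxy : x == y = false.
  by apply/negbTE; apply: contraTneq xy => ->; rewrite ltnn.
have l1x : l1 x = l x by rewrite ffunE nxy.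
have [|l' [r' l'x l'low]] := IHb l1.
  rewrite -ltnS; apply: leq_trans le; apply: proper_card; apply/properP; split.
    apply/subsetP => z; rewrite !inE l1x ffunE; have [->|//] := eqVneq z y.
    by rewrite ly (negPf (addr1_neq _)).
  exists y; first by rewrite inE ly eqxx.
  by rewrite inE l1x ffunE eqxx ly (negPf (addr1_neq _)).
exists l'; split=> //; first exact: (lowreach_trans r1 r').
move=> z zx; rewrite l'low // ffunE ifN //; apply: contraTneq zx => ->.
by rewrite -leqNgt ltnW.
Qed.

(** Each person is put in place, from the lowest upwards, without disturbing the
    people below him. *)
Lemma lowreach_all l l' : lowreach (n * n) l l'.
Proof.
suff H j : (j <= n)%N -> exists2 l1, lowreach (j * n) l l1 &
    forall y : 'I_n, (y < j)%N -> l1 y = l' y.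
  have [l1 r1 l1E] := H n (leqnn n).
  by suff -> : l' = l1 by []; apply/ffunP => y; rewrite l1E.
elim: j => [_|j IHj jn]; first by exists l => //; apply: lowreach0.
have [l1 r1 l1E] := IHj (ltnW jn); pose x := Ordinal jn.
have [|l2 [r2 l2x l2E]] := @lowreach_one n l1 x (l' x).
  rewrite -[ltnRHS]card_ord -cardsT; apply/proper_card/properP.
  by split; [apply/subsetP => y|exists x]; rewrite !inE // ltnn andbF.
exists l2; first by rewrite mulSnr; apply: lowreach_trans r1 r2.
move=> y; rewrite ltnS leq_eqVlt => /orP[/eqP e|lt].
  by have -> : y = x by apply/val_inj.
by rewrite l2E // l1E.
Qed.

End Perm.

(** * The exceptional configurations *)

Lemma Vc_const g (i j : 'I_M) : g \in Vc N M -> g (rshift n i) = g (rshift n j).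
Proof.
rewrite inE => /forallP/(_ (rshift n i))/forallP/(_ (rshift n j)).
by rewrite addnK !leq_addr => /eqP.
Qed.

Lemma VcNP g : g \notin Vc N M ->
  exists i j, g (rshift n i) != g (rshift n j).
Proof.
rewrite inE negb_forall => /existsP[k]; rewrite negb_forall => /existsP[k'].
rewrite negb_imply addnK; case: (split_ordP k) => [x ->|i ->].
  by rewrite (leqNgt n) (ltn_ord x).
case: (split_ordP k') => [x ->|j ->].
  by rewrite (leqNgt n x) (ltn_ord x) andbF.
by case/andP=> _ ne; exists i, j.
Qed.

Lemma reach_any f g : g \notin Vc N M -> reach (M + 3 * (n * n) + 2) f g.
Proof.
case/VcNP => i [j] /(perm_avoid (a := fun i => g (rshift n i)))[s sP].
have [t [l r1]] := align s f; pose l' : {ffun _} := [ffun x => g (lshift M x)].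
have [t' r2] := lowreach_all s l l' t.
rewrite -addnA; apply: reach_trans r1 _; apply: reach_trans r2 _.
apply: (@reach_trans _ _ 1 1); first exact: (reach_rotate s _ 0).
apply/reach1/move_place => [k|x]; last by rewrite ffunE.
by rewrite addr0 eq_sym.
Qed.

(** Suppose that a move ends with all controls in the room [r]. No control was
    in [r] before, since the highest one there would have left it. So every
    control moved and was the highest of his room; hence the controls were in
    pairwise different rooms, and one of them was in [r]. *)
Lemma Vc_no_pred f g : move f g -> g \notin Vc N M.
Proof.
move=> /moveP mv; apply/negP => gV; pose r := g (rshift n ord0).
have gE i : g (rshift n i) = r by apply: Vc_const.
have fr i : f (rshift n i) != r.
  apply/eqP => fi.
  case: (@arg_maxnP _ (rshift n i) (fun k => f k == r) val); rewrite ?fi //.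
  move=> k /eqP fk kmax.
  have /esym : top f k.
    by apply/topP => j fj; apply: kmax; rewrite fj fk.
  have := kmax (rshift n i); rewrite fi eqxx => /(_ isT).
  case: (split_ordP k) => [x e|j e].
    by rewrite e /= leqNgt ltn_addr.
  by rewrite -mv fk e gE eqxx.
have ftop i : top f (rshift n i) by rewrite -mv gE eq_sym.
have finj : injective (fun i => f (rshift n i)).
  move=> i j e; apply/(@rshift_inj n)/val_inj/eqP; rewrite eqn_leq.
  by apply/andP; split; apply: (topP _ _ (ftop _)).
have [h _ fh] := injF_bij finj.
by have := fr (h r); rewrite fh eqxx.
Qed.

(** The highest person alone is moved to the next room. *)
Lemma card_Vc : (#|Vc N M| <= #|~: Vc N M|)%N.
Proof.
pose k0 : 'I_N := rshift n ord_max.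
pose phi f : config N M := [ffun k => if k == k0 then f k + 1 else f k].
have phi_inj : injective phi.
  move=> f g /ffunP e; apply/ffunP => k; have := e k; rewrite !ffunE.
  by case: eqP => // _ /addIr.
rewrite -(card_imset _ phi_inj); apply/subset_leq_card/subsetP.
move=> _ /imsetP[f fV ->].
rewrite inE; apply/negP => /(Vc_const ord_max ord0); rewrite !ffunE eqxx ifN.
  by rewrite (Vc_const ord_max ord0 fV) => /eqP; rewrite (negPf (addr1_neq _)).
by apply/eqP => /rshift_inj.
Qed.

End Controls.

(** * All sizes, and the asymptotic bounds *)

Lemma size_split N M : 3 <= M -> M <= N ->
  exists n m, N = n + m.+3 /\ M = m.+3.
Proof. by move=> M3 MN; exists (N - M), (M - 3); lia. Qed.

Section AllSizes.
Variables N M : nat.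
Hypotheses (M3 : 3 <= M) (MN : M <= N).
Implicit Types f g : config N M.

Lemma reach_square f g : g \in ~: Vc N M -> reach (3 * N ^ 2) f g.
Proof.
have [n [m [eN eM]]] := size_split M3 MN; subst M N.
rewrite inE => gV; apply: reach_leq (reach_any f gV); rewrite -mulnn; nia.
Qed.

Lemma reach_connect c f g : reach c f g -> connect (@move N M) f g.
Proof. by case=> p [? <- _]; apply/connectP; exists p. Qed.

Lemma reach_dist c f g : reach c f g -> dist (@move N M) f g <= c.
Proof. by case=> p [pp <- le]; apply: leq_trans (dist_path pp) le. Qed.

Lemma dist_square f g : g \in ~: Vc N M -> dist (@move N M) f g <= 3 * N ^ 2.
Proof. by move=> gV; apply/reach_dist/reach_square. Qed.

Lemma card_config_leq : M ^ N <= 2 * #|~: Vc N M|.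
Proof.
have -> : M ^ N = #|Vc N M| + #|~: Vc N M|.
  by rewrite cardsC card_ffun !card_ord.
rewrite mul2n -addnn leq_add2r.
have [n [m [-> ->]]] := size_split M3 MN; exact: card_Vc.
Qed.

Lemma card_VcC_leq : #|~: Vc N M| <= M ^ N.
Proof. by apply: leq_trans (max_card _) _; rewrite card_ffun !card_ord. Qed.

Lemma VcC_scc : ~: Vc N M \in sccs (@move N M).
Proof.
have noV f g : move f g -> g \notin Vc N M.
  have [n [m [eN eM]]] := size_split M3 MN; subst M N; exact: Vc_no_pred.
have [g0 g0V] : exists g, g \in ~: Vc N M.
  apply/card_gt0P; rewrite -(ltn_pmul2l (m := 2)) // muln0.
  by apply: leq_trans card_config_leq; rewrite expn_gt0 (leq_trans _ M3).
apply/imsetP; exists g0 => //; apply/setP => f; rewrite [in RHS]inE in_setT /=.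
apply/idP/andP => [fV|[con _]].
  by split; [apply: reach_connect (reach_square g0 fV)
            |apply: reach_connect (reach_square f g0V)].
(* The last move of a nonempty walk cannot end in [Vc]. *)
case/connectP: con => p; case/lastP: p => [_ -> //|p h].
by rewrite rcons_path last_rcons inE => /andP[_ /noV hV] ->.
Qed.

End AllSizes.

Import numFieldNormedType.Exports.
Local Open Scope classical_set_scope.
Local Open Scope ring_scope.

Lemma eqO_nat (R : realType) (a b : nat -> nat) (c N0 : nat) :
    (0 < c)%N -> (forall N, (N0 <= N)%N -> (a N <= c * b N)%N) ->
  (fun N : nat => (a N)%:R : R) =O_\oo (fun N : nat => (b N)%:R : R).
Proof.
move=> c0 ab; apply/eqO_exP; exists c%:R; first by rewrite ltr0n.
exists N0 => // N /= le; rewrite !normr_nat -natrM ler_nat; exact: ab.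
Qed.

Theorem mainTheorem3 (R : realType) (M : nat) (hM : (3 <= M)%N) :
  ((forall N : nat, (M <= N)%N ->
      forall f g : config N M, g \in ~: Vc N M -> connect (@move N M) f g) /\
   (fun N : nat => (\max_(f : config N M) \max_(g in ~: Vc N M)
                      dist (@move N M) f g)%:R : R)
     =O_\oo (fun N : nat => (N ^ 2)%:R : R)) /\
  ((forall N : nat, (M <= N)%N -> ~: Vc N M \in sccs (@move N M)) /\
   (fun N : nat => #|~: Vc N M|%:R : R)
     =Theta_\oo (fun N : nat => (M ^ N)%:R : R) /\
   (fun N : nat => (diameter (@move N M) (~: Vc N M))%:R : R)
     =O_\oo (fun N : nat => (N ^ 2)%:R : R)).
Proof.
split; [split=> [N MN f g gV|]|split=> [N MN|]].
- exact: reach_connect (reach_square hM MN f gV).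
- apply: (@eqO_nat R _ _ 3 M) => // N MN.
  by apply/bigmax_leqP => f _; apply/bigmax_leqP => g gV; apply: dist_square.
- exact: VcC_scc.
split.
  rewrite eqThetaE bigThetaE; split.
    apply: (@eqO_nat R _ _ 1 0) => // N _; rewrite mul1n.
    exact: card_VcC_leq.
  rewrite eqOmegaO; apply: (@eqO_nat R _ _ 2 M) => // N.
  exact: card_config_leq.
apply: (@eqO_nat R _ _ 3 M) => // N MN.
by apply/bigmax_leqP => f _; apply/bigmax_leqP => g gV; apply: dist_square.
Qed.
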